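(* There exists a constant $C_4>0$ such that for every integer $r'\geq2$ there exists $m\leq C_4\,(r')^2\log(r')^2$ with $\tilde a_m<b_m$, where $\sum_{n\geq0}\tilde a_nt^n:=(1-t)^{-r'}f(t)$ and $\sum_{n\geq0}b_nt^n:=f(t)^2$.
   Context: $f(t):=\prod_{k\geq1}(1-t^k)^{-1}=\sum_{n\geq0}p(n)t^n$, where $p(n)$ is the number of partitions of $n$. *)

(* Defs.v *)
From HB Require Import structures.
From mathcomp Require Import all_boot all_order all_algebra.
From mathcomp Require Import boolp.

Set Implicit Arguments.
Unset Strict Implicit.
Unset Printing Implicit Defensive.

Import GRing.Theory.
Local Open Scope ring_scope.

(* A formal power series is represented by its coefficient sequence. *)
Definition fps (R : Type) := nat -> R.

Section FormalPowerSeries.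
Variable R : comUnitRingType.
Implicit Types u v w : fps R.

Definition fps_one : fps R := fun n => (n == 0%N)%:R.

Definition fps_mul u v : fps R := fun n => \sum_(i < n.+1) u i * v (n - i)%N.

Definition fps_exp u (k : nat) : fps R := iter k (fps_mul u) fps_one.

(* The first n coefficients of u^-1, obtained by solving
   \sum_(i <= k) u_(k - i) c_i = (k == 0) for c_k, k = 0, 1, ..., n - 1. *)
Fixpoint fps_inv_seq u (n : nat) : seq R :=
  if n is k.+1 then
    let c := fps_inv_seq u k in
    rcons c ((u 0%N)^-1 * ((k == 0%N)%:R - \sum_(i < k) u (k - i)%N * c`_i))
  else [::].

(* This is the inverse only when u 0 is a unit; see fps_mulV. *)
Definition fps_inv u : fps R := fun n => (fps_inv_seq u n.+1)`_n.

(* The series 1 - t^k, for k >= 1. *)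
Definition one_sub_t (k : nat) : fps R :=
  fun n => (n == 0%N)%:R - (n == k)%:R.

Lemma size_fps_inv_seq u n : size (fps_inv_seq u n) = n.
Proof. by elim: n => //= n IHn; rewrite size_rcons IHn. Qed.

Lemma nth_fps_inv_seq u n i : (i < n)%N -> (fps_inv_seq u n)`_i = fps_inv u i.
Proof.
elim: n => // n IHn; rewrite ltnS leq_eqVlt => /predU1P[-> //|lt_in].
by rewrite /= nth_rcons size_fps_inv_seq lt_in IHn.
Qed.

Lemma fps_invE u n :
  fps_inv u n =
    (u 0%N)^-1 * ((n == 0%N)%:R - \sum_(i < n) u (n - i)%N * fps_inv u i).
Proof.
rewrite {1}/fps_inv /= nth_rcons size_fps_inv_seq ltnn eqxx.
by congr (_ * (_ - _)); apply: eq_bigr => i _; rewrite nth_fps_inv_seq.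
Qed.

Lemma fps_mul_poly u v N n : (n < N)%N ->
  fps_mul u v n = ((\poly_(i < N) u i) * (\poly_(i < N) v i))`_n.
Proof.
move=> lt_nN; rewrite coefM; apply: eq_bigr => i _; rewrite !coef_poly.
rewrite (leq_trans _ lt_nN) ?ltnS ?leq_ord //.
by rewrite (leq_trans _ lt_nN) // ltnS leq_subr.
Qed.

Lemma fps_mulC : commutative fps_mul.
Proof.
by move=> u v; apply/funext => n; rewrite !(fps_mul_poly _ _ (ltnSn n)) mulrC.
Qed.

Lemma fps_mulV u : u 0%N \is a GRing.unit -> fps_mul u (fps_inv u) = fps_one.
Proof.
move=> Uu; apply/funext => n; rewrite fps_mulC /fps_mul big_ord_recr /= subnn.
rewrite [fps_inv u n]fps_invE mulrC mulVKr //.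
under eq_bigr do rewrite mulrC.
by rewrite addrC subrK.
Qed.

(* u and p have the same coefficients up to degree N - 1. *)
Definition fps_agree N u (p : {poly R}) := forall i, (i < N)%N -> u i = p`_i.

Lemma fps_agree_mul N u v p q : fps_agree N u p -> fps_agree N v q ->
  fps_agree N (fps_mul u v) (p * q).
Proof.
move=> up vq n lt_nN; rewrite coefM; apply: eq_bigr => i _.
rewrite up ?vq // (leq_trans _ lt_nN) ?ltnS ?leq_subr ?leq_ord //.
Qed.

Lemma fps_agree_poly N u : fps_agree N u (\poly_(i < N) u i).
Proof. by move=> i lt_iN; rewrite coef_poly lt_iN. Qed.

Lemma fps_agree_one N : fps_agree N fps_one 1.
Proof. by move=> i _; rewrite coef1. Qed.

Lemma fps_mulA : associative fps_mul.
Proof.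
move=> u v w; apply/funext => n.
have A x := @fps_agree_poly n.+1 x.
rewrite (fps_agree_mul (A u) (fps_agree_mul (A v) (A w)) (ltnSn n)).
by rewrite (fps_agree_mul (fps_agree_mul (A u) (A v)) (A w) (ltnSn n)) mulrA.
Qed.

Lemma fps_mul1 : left_id fps_one fps_mul.
Proof.
move=> u; apply/funext => n.
have A x := @fps_agree_poly n.+1 x.
rewrite (fps_agree_mul (@fps_agree_one n.+1) (A u) (ltnSn n)) mul1r.
by rewrite coef_poly ltnSn.
Qed.

HB.instance Definition _ :=
  Monoid.isComLaw.Build (fps R) fps_one fps_mul fps_mulA fps_mulC fps_mul1.

Lemma fps_inv_uniq u v : u 0%N \is a GRing.unit ->
  fps_mul u v = fps_one -> v = fps_inv u.
Proof.
move=> Uu uv1; rewrite -[v]fps_mul1 -(fps_mulV Uu) [fps_mul u _]fps_mulC.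
by rewrite -fps_mulA uv1 fps_mulC fps_mul1.
Qed.

Lemma fps_inv_one_sub_t k n : (0 < k)%N ->
  fps_inv (one_sub_t k) n = (k %| n)%:R.
Proof.
move=> k_gt0; rewrite -(@fps_inv_uniq _ (fun n => (k %| n)%:R)) //.
  by rewrite /one_sub_t eqxx ltn_eqF // subr0 unitr1.
apply/funext => m; rewrite /fps_mul /one_sub_t /fps_one.
under eq_bigr do rewrite mulrBl.
rewrite sumrB big_ord_recl /= mul1r subn0 big1 ?addr0 => [|i _]; last first.
  by rewrite mul0r.
have [le_km|lt_mk] := leqP k m.
  rewrite (bigD1 (Ordinal (le_km : k < m.+1)%N)) //= eqxx mul1r big1 ?addr0.
    by rewrite dvdn_subl // subrr gtn_eqF // (leq_trans k_gt0).
  by move=> i ne_ik; rewrite -val_eqE /= in ne_ik; rewrite (negbTE ne_ik) mul0r.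
rewrite big1 ?subr0 => [|i _].
  by case: m lt_mk => [|m] lt_mk; [rewrite dvdn0 | rewrite gtnNdvd].
by rewrite ltn_eqF ?mul0r // (leq_ltn_trans _ lt_mk) // -ltnS.
Qed.

End FormalPowerSeries.

Arguments fps_one {R}.

(* \prod_(k >= 1) (1 - t^k)^-1: factors with k > n do not affect the
   coefficient of t^n, so that coefficient is read off the product of the
   first n factors; see euler_fpsE. *)
Definition euler_fps : fps int := fun n =>
  (\big[@fps_mul int/fps_one]_(1 <= k < n.+1) fps_inv (one_sub_t int k)) n.

Definition geom_trunc (k N : nat) : {poly int} := \sum_(j < N.+1) 'X^(k * j).

Lemma geom_truncP k N : (0 < k)%N ->
  fps_agree N.+1 (fps_inv (one_sub_t int k)) (geom_trunc k N).
Proof.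
move=> k_gt0 i le_iN; rewrite fps_inv_one_sub_t // coef_sum.
under eq_bigr do rewrite coefXn.
have [/dvdnP[j def_i]|k'i] := boolP (k %| i)%N.
  have lt_jN : (j < N.+1)%N.
    by rewrite (leq_ltn_trans _ le_iN) // def_i leq_pmulr.
  rewrite (bigD1 (Ordinal lt_jN)) //= def_i mulnC eqxx big1 ?addr0 // => l ne_lj.
  by rewrite eqn_pmul2l // eq_sym; rewrite -val_eqE /= in ne_lj; rewrite (negbTE ne_lj).
rewrite big1 // => j _; case: eqP => // def_i.
by rewrite def_i dvdn_mulr in k'i.
Qed.

Lemma euler_prod_agree K N :
  fps_agree N.+1
    (\big[@fps_mul int/fps_one]_(1 <= k < K.+1) fps_inv (one_sub_t int k))
    (\prod_(1 <= k < K.+1) geom_trunc k N).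
Proof.
elim: K => [|K IHK]; first by rewrite !big_geq //; apply: fps_agree_one.
by rewrite !(big_nat_recr K.+1) //=; apply: fps_agree_mul => //; apply: geom_truncP.
Qed.

Lemma euler_fpsE n K : (n <= K)%N ->
  euler_fps n =
    (\big[@fps_mul int/fps_one]_(1 <= k < K.+1) fps_inv (one_sub_t int k)) n.
Proof.
elim: K => [|K IHK]; first by rewrite leqn0 => /eqP->.
rewrite leq_eqVlt => /predU1P[-> //|lt_nK].
rewrite (big_nat_recr K.+1) //= IHK // /fps_mul big_ord_recr /= subnn.
rewrite fps_inv_one_sub_t // dvdn0 mulr1 big1 ?add0r // => i _.
rewrite fps_inv_one_sub_t // gtnNdvd ?mulr0 ?subn_gt0 //.
by rewrite ltnS (leq_trans (leq_subr _ _)) // -ltnS ltnW.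
Qed.

(* A partition of n is given by the multiplicity m i of each part i + 1. *)
Definition num_partitions (n : nat) : nat :=
  #|[set m : {ffun 'I_n -> 'I_n.+1} | \sum_(i < n) i.+1 * m i == n]%N|.

Lemma euler_fps_partitions n : euler_fps n = (num_partitions n)%:R.
Proof.
rewrite /euler_fps (@euler_prod_agree n n n) // big_add1 /= big_mkord.
rewrite /geom_trunc bigA_distr_bigA coef_sum /num_partitions -sum1_card natr_sum.
rewrite [RHS]big_mkcond; apply: eq_bigr => m _ /=.
by rewrite inE prodrXr coefXn eq_sym; case: eqP.
Qed.

Lemma fps_exp_one_sub_t0 r : fps_exp (one_sub_t int 1) r 0%N = 1.
Proof.
elim: r => // r; rewrite /fps_exp /= => IHr.
by rewrite /fps_mul big_ord1 /= IHr mulr1.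
Qed.

(* (1 - t)^(- r) f(t); the inverse exists by fps_exp_one_sub_t0. *)
Definition a_tilde (r : nat) : fps int :=
  fps_mul (fps_inv (fps_exp (one_sub_t int 1) r)) euler_fps.

Definition b_coef : fps int := fps_exp euler_fps 2.

(* Main.v *)
(** Write [F_N(x)] for the sum of [p(i) x^i] over [i < N], and suppose
    [b_m <= a_m] for all [m < 2N].  Comparing partial sums gives
    [F_N(x)^2 <= (1 - x)^-r F_2N(x)].  Take [y = 1 - 1/D] and [x = y^2].  The
    bound [F_2N(y) <= 512^D] makes the tail [F_2N(x) - F_N(x)], which is at
    most [y^N F_2N(y)], at most [1] as soon as [N >= 9 D^2], so that
    [F_N(x) <= 2 D^r].  On the other hand, keeping only the partitions into
    distinct parts of size at most [K = D/4] gives [F_N(x) >= (3/2)^K].  These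
    bounds contradict each other when [K] is a large multiple of [r log r],
    and then [2N = 288 K^2] is of order [r^2 (log r)^2]. *)
Require Import Defs.
From mathcomp Require Import all_boot all_order all_algebra.
From mathcomp Require Import reals exp.
From mathcomp Require Import zify ring lra.
Import Order.TTheory GRing.Theory Num.Theory.
Local Open Scope ring_scope.

Set Implicit Arguments.
Unset Strict Implicit.
Unset Printing Implicit Defensive.

(** * Coefficientwise comparison of integer polynomials *)

Section PolynomialCoefficients.
Implicit Types p q : {poly int}.

Definition coef_ge0 p := forall i, 0 <= p`_i.

Definition coef_le p q := forall i, p`_i <= q`_i.

Lemma coef_ge0M p q : coef_ge0 p -> coef_ge0 q -> coef_ge0 (p * q).
Proof. by move=> p0 q0 i; rewrite coefM sumr_ge0 // => j _; rewrite mulr_ge0. Qed.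

Lemma coef_leM p q p' q' : coef_ge0 p -> coef_ge0 p' -> coef_le p q ->
  coef_le p' q' -> coef_le (p * p') (q * q').
Proof. by move=> p0 p'0 pq pq' i; rewrite !coefM ler_sum // => j _; rewrite ler_pM. Qed.

Lemma coef_ge0_geom_trunc k N : coef_ge0 (geom_trunc k N).
Proof. by move=> i; rewrite coef_sum sumr_ge0 // => j _; rewrite coefXn. Qed.

Lemma coef_ge0_1DXn k : coef_ge0 (1 + 'X^k).
Proof. by move=> i; rewrite coefD coef1 coefXn addr_ge0. Qed.

Lemma coef_le_1DXn_geom_trunc k N : (0 < N)%N ->
  coef_le (1 + 'X^k) (geom_trunc k N).
Proof.
case: N => // N _ i; rewrite /geom_trunc 2!big_ord_recl /= muln0 expr0.
rewrite /bump /= muln1 addrA [leRHS]coefD lerDl coef_sum sumr_ge0 // => j _.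
by rewrite coefXn.
Qed.

Lemma coef_ge0_prod_geom_trunc K N :
  coef_ge0 (\prod_(1 <= k < K.+1) geom_trunc k N).
Proof.
apply: big_ind => [i|p q|k _]; first by rewrite coef1.
- exact: coef_ge0M.
- exact: coef_ge0_geom_trunc.
Qed.

Lemma coef_ge0_prod_1DXn K : coef_ge0 (\prod_(1 <= k < K.+1) (1 + 'X^k)).
Proof.
apply: big_ind => [i|p q|k _]; first by rewrite coef1.
- exact: coef_ge0M.
- exact: coef_ge0_1DXn.
Qed.

(** The left side counts partitions into distinct parts of size at most [K]. Its factors are
    dominated one by one, and each remaining factor with [k > K] dominates [1]. *)
Lemma coef_le_prod_1DXn_geom_trunc K K' N : (0 < N)%N -> (K <= K')%N ->
  coef_le (\prod_(1 <= k < K.+1) (1 + 'X^k)) (\prod_(1 <= k < K'.+1) geom_trunc k N).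
Proof.
move=> N0 leK.
have C1 : coef_ge0 1 by move=> i; rewrite coef1.
rewrite (@big_cat_nat _ _ _ K.+1 1 K'.+1) //=.
rewrite -[X in coef_le X]mulr1; apply: coef_leM => //.
- exact: coef_ge0_prod_1DXn.
- elim: K {leK} => [|K IHK]; first by rewrite !big_geq.
  rewrite !(big_nat_recr K.+1) //=; apply: coef_leM => //.
  + exact: coef_ge0_prod_1DXn.
  + exact: coef_ge0_1DXn.
  + exact: coef_le_1DXn_geom_trunc.
- apply: (big_ind (coef_le 1)) => [//|p q p1 q1|k _ i].
    by rewrite -[X in coef_le X]mulr1; apply: coef_leM.
  apply: le_trans (coef_le_1DXn_geom_trunc k N0 i).
  by rewrite coefD lerDl coefXn.
Qed.

Lemma size_prod_1DXn K :
  (size (\prod_(1 <= k < K.+1) (1 + 'X^k) : {poly int})%R <= (K ^ 2).+1)%N.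
Proof.
elim: K => [|K IHK]; first by rewrite big_geq // size_poly1.
rewrite (big_nat_recr K.+1) //=; apply: leq_trans (size_polyMleq _ _) _.
have : (size (1 + 'X^(K.+1) : {poly int})%R <= K.+2)%N.
  by apply: leq_trans (size_polyD _ _) _; rewrite size_poly1 size_polyXn geq_max leqnn.
by move: IHK; rewrite -!mulnn; move: (size _) (size _) => s t; nia.
Qed.

End PolynomialCoefficients.

(** Each factor of the falling factorial [(2n)(2n-1)...(n+1)] is at least [n], and this product is
    [n!] times a binomial coefficient of row [2n], hence at most [4^n n!]. *)
Lemma exp_le_4exp_fact n : (n ^ n <= 4 ^ n * n`!)%N.
Proof.
apply: (@leq_trans ((n + n) ^_ n)).
  rewrite ffact_prod -{2}[n]card_ord -prod_nat_const.
  by apply: leq_prod => i _; have := ltn_ord i; lia.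
rewrite -bin_ffact leq_mul2r; apply/orP; right.
have n_le : (n < (n + n).+1)%N by lia.
rewrite -[4%N]/(2 ^ 2)%N -expnM mul2n -addnn -[2%N]/(1 + 1)%N expnDn.
by rewrite (bigD1 (Ordinal n_le)) //= !exp1n !muln1 leq_addr.
Qed.

(** Powers of [1/(1 - t)], whose coefficients are all [1], allow nonnegativity and size bounds by
    induction on [r]. *)
Lemma fps_inv_exp_one_sub_t r :
  fps_inv (fps_exp (one_sub_t int 1) r) = fps_exp (fps_inv (one_sub_t int 1)) r.
Proof.
apply/esym/fps_inv_uniq; first by rewrite fps_exp_one_sub_t0 unitr1.
elim: r => [|r IHr]; first by rewrite fps_mul1.
rewrite /fps_exp /= Monoid.mulmACA /= -!/(fps_exp _ _) IHr fps_mulV ?fps_mul1 //.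
Qed.

Lemma fps_mul_ge0 (u v : fps int) : (forall i, 0 <= u i) -> (forall i, 0 <= v i) ->
  forall i, 0 <= fps_mul u v i.
Proof. by move=> u0 v0 i; rewrite sumr_ge0 // => j _; rewrite mulr_ge0. Qed.

Lemma fps_inv_exp_one_sub_t_ge0 r i :
  0 <= fps_inv (fps_exp (one_sub_t int 1) r) i.
Proof.
rewrite fps_inv_exp_one_sub_t; elim: r i => [|r IHr] i.
  by rewrite /fps_exp /= /fps_one.
by apply: fps_mul_ge0 => // j; rewrite fps_inv_one_sub_t.
Qed.

(** * Partial sums of power series at a real point *)

Section PartialSums.
Variable R : realFieldType.
Implicit Types (u v : fps int) (p q : {poly int}) (x y : R).

Definition psum N u x : R := \sum_(i < N) (u i)%:~R * x ^+ i.

Lemma horner_intr_wide n p x : (size p <= n)%N ->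
  (map_poly intr p).[x] = \sum_(i < n) (p`_i)%:~R * x ^+ i.
Proof.
move=> le_pn; rewrite (@horner_coef_wide _ n).
  by apply: eq_bigr => i _; rewrite coef_map.
by rewrite size_map_inj_poly //; apply: intr_inj.
Qed.

Lemma psum_le_horner N u p x : 0 <= x -> coef_ge0 p ->
  (forall i, (i < N)%N -> u i <= p`_i) -> psum N u x <= (map_poly intr p).[x].
Proof.
move=> x0 p0 up; rewrite (@horner_intr_wide (N + size p)) ?leq_addl //.
rewrite big_split_ord /= -[leLHS]addr0 lerD ?sumr_ge0 // => [|i _].
  by apply: ler_sum => i _; rewrite ler_wpM2r ?exprn_ge0 // ler_int up.
by rewrite mulr_ge0 ?exprn_ge0 // ler0z.
Qed.

Lemma horner_le_psum N u p x : 0 <= x -> (size p <= N)%N ->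
  (forall i, (i < N)%N -> p`_i <= u i) -> (map_poly intr p).[x] <= psum N u x.
Proof.
move=> x0 szp pu; rewrite (horner_intr_wide _ szp).
by apply: ler_sum => i _; rewrite ler_wpM2r ?exprn_ge0 // ler_int pu.
Qed.

Lemma horner_poly_intr N u x : (map_poly intr (\poly_(i < N) u i)).[x] = psum N u x.
Proof.
rewrite (horner_intr_wide _ (size_poly _ _)).
by apply: eq_bigr => i _; rewrite coef_poly ltn_ord.
Qed.

Lemma coef_ge0_poly N u : (forall i, 0 <= u i) -> coef_ge0 (\poly_(i < N) u i).
Proof. by move=> u0 i; rewrite coef_poly; case: ifP. Qed.

Lemma psum_ge0 N u x : 0 <= x -> (forall i, 0 <= u i) -> 0 <= psum N u x.
Proof. by move=> x0 u0; rewrite sumr_ge0 // => i _; rewrite mulr_ge0 ?exprn_ge0 ?ler0z. Qed.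

(** The product of the two truncations is exact below degree [N]; its further terms are
    nonnegative. *)
Lemma psum_mul_le N u v x : 0 <= x -> (forall i, 0 <= u i) ->
  (forall i, 0 <= v i) -> psum N (fps_mul u v) x <= psum N u x * psum N v x.
Proof.
move=> x0 u0 v0; rewrite -!horner_poly_intr -[leRHS]hornerM -rmorphM /= horner_poly_intr.
apply: psum_le_horner => // [|i iN]; first by apply: coef_ge0M; apply: coef_ge0_poly.
by rewrite (fps_agree_mul (@fps_agree_poly _ N u) (@fps_agree_poly _ N v)).
Qed.

(** The product of the truncations has degree below [2N], and its coefficients only miss nonnegative
    summands of the convolution. *)
Lemma psum_mul_ge N u v x : 0 <= x -> (forall i, 0 <= u i) ->
  (forall i, 0 <= v i) -> psum N u x * psum N v x <= psum (N + N) (fps_mul u v) x.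
Proof.
move=> x0 u0 v0; rewrite -2!horner_poly_intr -hornerM -rmorphM.
apply: horner_le_psum => // [|i _].
  apply: leq_trans (size_polyMleq _ _) _.
  move: (size_poly N u) (size_poly N v); move: (size _) (size _) => s t; lia.
rewrite coefM; apply: ler_sum => j _; rewrite !coef_poly.
by case: ifP; case: ifP; rewrite ?mulr0 ?mul0r // mulr_ge0.
Qed.

Lemma geom_sum_le N x : 0 <= x < 1 -> \sum_(i < N) x ^+ i <= (1 - x)^-1.
Proof.
move=> /andP[x0 x1]; rewrite -[leRHS]mul1r ler_pdivlMr ?subr_gt0 // mulrC.
by rewrite -opprB mulNr -subrX1 opprB gerBl exprn_ge0.
Qed.

Lemma psum_exp_inv_one_sub_t_le N r x : 0 <= x < 1 ->
  psum N (fps_inv (fps_exp (one_sub_t int 1) r)) x <= (1 - x) ^- r.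
Proof.
move=> x01; have [x0 x1] := andP x01; rewrite fps_inv_exp_one_sub_t -exprVn.
have exp_ge0 k i : 0 <= fps_exp (fps_inv (one_sub_t int 1)) k i.
  by rewrite -fps_inv_exp_one_sub_t fps_inv_exp_one_sub_t_ge0.
have inv_ge0 i : 0 <= fps_inv (one_sub_t int 1) i by rewrite fps_inv_one_sub_t.
elim: r => [|r IHr].
  case: N => [|N]; first by rewrite /psum big_ord0.
  rewrite /psum big_ord_recl /= mulr1 big1 ?addr0 // => i _.
  by rewrite mul0r.
rewrite exprS; apply: le_trans (psum_mul_le _ _ _ _) _ => //.
apply: ler_pM; rewrite ?psum_ge0 //.
apply: le_trans (geom_sum_le N x01); apply: ler_sum => i _.
by rewrite fps_inv_one_sub_t // dvd1n mul1r.
Qed.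

(** The quantity [(1 - d)^n (1 + n d)] does not increase with [n]. *)
Lemma exp_1B_le (d : R) n : 0 <= d <= 1 -> (1 - d) ^+ n <= (1 + n%:R * d)^-1.
Proof.
move=> /andP[d0 d1].
rewrite -[leRHS]mul1r ler_pdivlMr; last by rewrite ltr_wpDr // mulr_ge0.
elim: n => [|n IHn]; first by rewrite expr0; lra.
apply: le_trans IHn; rewrite exprSr -mulrA ler_wpM2l ?exprn_ge0 ?subr_ge0 //.
have : 0 <= n%:R :> R by [].
rewrite -natr1; nra.
Qed.

Lemma exp_1B_ge (d : R) n : 0 <= d <= 1 -> 1 - n%:R * d <= (1 - d) ^+ n.
Proof.
move=> /andP[d0 d1]; elim: n => [|n IHn]; first by rewrite expr0; lra.
apply: (@le_trans _ _ ((1 - n%:R * d) * (1 - d))).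
  by have : 0 <= n%:R :> R by []; rewrite -natr1; nra.
by rewrite exprSr ler_wpM2r // subr_ge0.
Qed.

(** The term [4^-T / 3] makes the induction close: with [q = 4^-T], the step reduces to [q^2 <= q].
    What matters later is the uniform bound [2/3]. *)
Lemma prod_1B_inv4_ge T :
  2 / 3 + 4 ^- T / 3 <= \prod_(1 <= i < T.+1) (1 - 4 ^- i) :> R.
Proof.
elim: T => [|T IHT]; first by rewrite big_geq // expr0; lra.
rewrite (big_nat_recr T.+1) //=.
have q0 : 0 < 4 ^- T :> R by rewrite invr_gt0 exprn_gt0.
have q1 : 4 ^- T <= 1 :> R by rewrite invf_le1 ?exprn_gt0 // exprn_ege1 // ler1n.
rewrite exprS invfM; move: IHT q0 q1.
set q := 4 ^- T; set P := \prod_(_ <= _ < _) _ => IHT q0 q1.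
apply: (@le_trans _ _ ((2 / 3 + q / 3) * (1 - 4^-1 * q))); first nra.
by apply: ler_wpM2r => //; lra.
Qed.

(** * Exponential upper bound for the partition series at [1 - 1/D] *)

Section EulerProduct.
Variables (D : nat) (y : R).
Hypotheses (D_gt0 : (0 < D)%N) (def_y : y = 1 - D%:R^-1).

Let y_ge0 : 0 <= y.
Proof. by rewrite def_y subr_ge0 invf_le1 ?ltr0n // ler1n. Qed.

Let y_lt1 : y < 1.
Proof. by rewrite def_y gtrBl invr_gt0 ltr0n. Qed.

Let exp_y_lt1 k : y ^+ k.+1 < 1.
Proof. by rewrite exprn_ilt1. Qed.

Let exp_y_le k : y ^+ k <= (1 + k%:R / D%:R)^-1.
Proof.
rewrite def_y; apply: exp_1B_le.
by rewrite invr_ge0 ler0n invf_le1 ?ltr0n // ler1n.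
Qed.

(* Here [1 - y^k >= k / 4D], which bounds the product below by L! / (4D)^L with
   L = 3D; a cruder factorwise bound would cost a logarithm in the exponent. *)
Lemma euler_prod_first_ge :
  (3 / 16) ^+ (3 * D) <= \prod_(1 <= k < (3 * D).+1) (1 - y ^+ k).
Proof.
set L := (3 * D)%N.
have D0 : 0 < D%:R :> R by rewrite ltr0n.
(* One factor [4] comes from [k / 4D], the other pays for [L^L <= 4^L L!]. *)
have -> : 3 / 16 = (4 * (4 * D%:R))^-1 * L%:R :> R.
  by rewrite /L natrM; field; rewrite gt_eqF.
rewrite exprMn exprVn exprMn invfM.
apply: (@le_trans _ _ ((4 * D%:R) ^- L * L`!%:R)).
  rewrite -mulrA mulrCA ler_wpM2l ?invr_ge0 ?exprn_ge0 ?mulr_ge0 //.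
  rewrite mulrC ler_pdivrMr ?exprn_gt0 // -!natrX -natrM ler_nat mulnC.
  exact: exp_le_4exp_fact.
rewrite fact_prod natr_prod -exprVn.
have -> : (4 * D%:R)^-1 ^+ L = \prod_(1 <= k < L.+1) (4 * D%:R)^-1 :> R.
  by rewrite prodr_const_nat subn1.
rewrite -big_split /= big_nat [leRHS]big_nat; apply: ler_prod => k /andP[k1 kL].
rewrite mulr_ge0 ?invr_ge0 ?mulr_ge0 //=.
apply: (@le_trans _ _ (1 - (1 + k%:R / D%:R)^-1)); last by rewrite lerB.
have k0 : 0 < k%:R :> R by rewrite ltr0n.
have -> : 1 - (1 + k%:R / D%:R)^-1 = k%:R / (D%:R + k%:R) :> R.
  by field; rewrite !gt_eqF ?addr_gt0.
rewrite [leLHS]mulrC ler_wpM2l ?(ltW k0) // lef_pV2 ?posrE ?mulr_gt0 ?addr_gt0 //.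
have : k%:R <= 3 * D%:R :> R by rewrite -natrM ler_nat.
lra.
Qed.

(* Factors are grouped in blocks of length 3D: since y^(3D) <= 1/4, each factor
   of the i-th block is at least 1 - 4^-i. *)
Lemma euler_prod_ge T :
  (3 / 16 * \prod_(1 <= i < T.+1) (1 - 4 ^- i)) ^+ (3 * D)
    <= \prod_(1 <= k < (T.+1 * (3 * D)).+1) (1 - y ^+ k).
Proof.
have q_ge0 i : 0 <= 1 - 4 ^- i :> R.
  by rewrite subr_ge0 invf_le1 ?exprn_gt0 // exprn_ege1 // ler1n.
elim: T => [|T IHT].
  by rewrite big_geq // mulr1 mul1n euler_prod_first_ge.
rewrite (big_nat_recr T.+1) //= mulrA exprMn.
rewrite (@big_cat_nat _ _ _ (T.+1 * (3 * D)).+1 1 (T.+2 * (3 * D)).+1) //=; last first.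
  by rewrite ltnS leq_mul2r leqnSn orbT.
apply: ler_pM => //; first by rewrite exprn_ge0 // mulr_ge0 ?divr_ge0 // prodr_ge0.
  exact: exprn_ge0.
have -> : (1 - 4 ^- T.+1) ^+ (3 * D) =
    \prod_((T.+1 * (3 * D)).+1 <= k < (T.+2 * (3 * D)).+1) (1 - 4 ^- T.+1) :> R.
  by rewrite prodr_const_nat subSS -mulnBl subSnn mul1n.
rewrite big_nat [leRHS]big_nat; apply: ler_prod => k /andP[k1 _].
rewrite q_ge0 /= lerB //.
apply: (@le_trans _ _ (y ^+ ((3 * D) * T.+1))).
  by rewrite ler_wiXn2l ?(ltW y_lt1) // mulnC ltnW.
rewrite exprM -exprVn lerXn2r ?nnegrE ?exprn_ge0 ?invr_ge0 //.
by apply: le_trans (exp_y_le _) _; rewrite natrM mulfK ?pnatr_eq0 -?lt0n.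
Qed.

(** Since [N <= K], the finite product has the right coefficients up to degree [N]; each truncated
    geometric series is then bounded by its full sum. *)
Lemma psum_euler_le_prod N K : (N <= K)%N ->
  psum N.+1 euler_fps y <= \prod_(1 <= k < K.+1) (1 - y ^+ k)^-1.
Proof.
move=> leNK.
apply: (@le_trans _ _ (map_poly intr (\prod_(1 <= k < K.+1) geom_trunc k N)).[y]).
  apply: psum_le_horner => // [|i iN]; first exact: coef_ge0_prod_geom_trunc.
  by rewrite (@euler_fpsE i K) ?(leq_trans _ leNK) // (@euler_prod_agree K N).
rewrite rmorph_prod horner_prod big_nat [leRHS]big_nat.
apply: ler_prod => -[//|k] _.
have -> : (map_poly intr (geom_trunc k.+1 N)).[y] = \sum_(j < N.+1) (y ^+ k.+1) ^+ j.
  rewrite rmorph_sum horner_sum; apply: eq_bigr => j _.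
  by rewrite /= map_polyXn hornerXn exprM.
rewrite sumr_ge0 => [|j _]; last by rewrite !exprn_ge0.
by rewrite geom_sum_le // exprn_ge0 ?exp_y_lt1.
Qed.

Lemma psum_euler_le N : psum N.+1 euler_fps y <= 512 ^+ D.
Proof.
(* The product is extended to [N + 1] full blocks of length [3D]. *)
have K_ge : (N <= N.+1 * (3 * D))%N.
  by rewrite (leq_trans (leqnSn N)) // leq_pmulr // muln_gt0.
apply: le_trans (psum_euler_le_prod K_ge) _.
rewrite prodfV -[leRHS]invrK lef_pV2 ?posrE ?invr_gt0 ?exprn_gt0 //; last first.
  by rewrite big_nat prodr_gt0 // => -[//|k] _; rewrite subr_gt0 exp_y_lt1.
apply: le_trans (euler_prod_ge N); rewrite -exprVn.
(* Here [1/8 = 3/16 * 2/3], and the cube comes from the block length [3D]. *)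
have -> : 512^-1 = (8^-1) ^+ 3 :> R by rewrite exprVn; congr (_^-1); ring.
have q_ge0 : 0 <= 4 ^- N :> R by rewrite invr_ge0 exprn_ge0.
have := prod_1B_inv4_ge N; set P := \prod_(_ <= _ < _) _ => P_ge.
by rewrite -exprM lerXn2r ?nnegrE; lra.
Qed.

End EulerProduct.

(** * Lower bound, tail estimate and the resulting inequality *)

Lemma euler_fps_ge0 n : 0 <= euler_fps n.
Proof. by rewrite euler_fps_partitions. Qed.

(** The condition [K^2 < N] lets the whole product of the [1 + X^k] fit below degree [N], so
    truncation loses none of it. *)
Lemma psum_euler_ge_prod K N x : 0 <= x -> (K ^ 2 < N)%N ->
  \prod_(1 <= k < K.+1) (1 + x ^+ k) <= psum N euler_fps x.
Proof.
move=> x0 ltKN.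
have K_le : (K <= N)%N by case: K ltKN => // K; rewrite -mulnn; nia.
have -> : \prod_(1 <= k < K.+1) (1 + x ^+ k) =
    (map_poly intr (\prod_(1 <= k < K.+1) (1 + 'X^k) : {poly int})).[x].
  rewrite rmorph_prod horner_prod; apply: eq_bigr => k _.
  by rewrite rmorphD /= rmorph1 map_polyXn hornerD hornerXn hornerC.
apply: horner_le_psum => // [|i iN]; first exact: leq_trans (size_prod_1DXn K) _.
rewrite (@euler_fpsE i N) ?(ltnW iN) // (@euler_prod_agree N N i) ?(leqW iN) //.
by apply: coef_le_prod_1DXn_geom_trunc => //; apply: leq_trans ltKN.
Qed.

(** For [i >= N], [y^(2i) <= y^N y^i]. *)
Lemma psum_tail_le N u y : 0 <= y <= 1 -> (forall i, 0 <= u i) ->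
  psum (N + N) u (y ^+ 2) <= psum N u (y ^+ 2) + y ^+ N * psum (N + N) u y.
Proof.
move=> /andP[y0 y1] u0.
have term_ge0 i : 0 <= (u i)%:~R * y ^+ i by rewrite mulr_ge0 ?exprn_ge0 ?ler0z.
rewrite /psum !big_split_ord /= lerD2l mulrDr.
rewrite -[leLHS]add0r lerD ?mulr_ge0 ?exprn_ge0 ?sumr_ge0 //.
rewrite mulr_sumr; apply: ler_sum => i _.
rewrite -exprM mulrCA -exprD ler_wpM2l ?ler0z // ler_wiXn2l //; lia.
Qed.

Lemma exp_le_of_b_le_a K r : (0 < K)%N ->
  (forall m, (m < 288 * K ^ 2)%N -> b_coef m <= a_tilde r m) ->
  (3 / 2) ^+ K <= 2 * (4 * K)%:R ^+ r :> R.
Proof.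
move=> K0 b_le_a; set D := (4 * K)%N; set N := (9 * D * D)%N.
have defN : (288 * K ^ 2 = N + N)%N by rewrite /N /D; lia.
have D0 : (0 < D)%N by rewrite muln_gt0.
have D0r : 0 < D%:R :> R by rewrite ltr0n.
have dD : 0 <= (D%:R^-1 : R) <= 1 by rewrite invr_ge0 ler0n invf_le1 // ler1n.
have [d0 d1] := andP dD.
set y : R := 1 - D%:R^-1; set x := y ^+ 2.
have y0 : 0 <= y by rewrite subr_ge0.
have y1 : y <= 1 by rewrite gerBl.
have x0 : 0 <= x by rewrite exprn_ge0.
(* With [d = 1/D], [1 - x = d (2 - d)]. *)
have d_le : D%:R^-1 <= 1 - x by rewrite /x /y; nra.
have x1 : x < 1 by have : 0 < D%:R^-1 :> R by [rewrite invr_gt0]; lra.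
set F := psum N euler_fps x.
have F_ge : (3 / 2) ^+ K <= F.
  apply: le_trans (psum_euler_ge_prod (K := K) _ _) => //; last first.
    by rewrite /N /D -mulnn; nia.
  have -> : (3 / 2) ^+ K = \prod_(1 <= k < K.+1) (3 / 2) :> R.
    by rewrite prodr_const_nat subn1.
  rewrite big_nat [leRHS]big_nat; apply: ler_prod => k /andP[_ kK].
  rewrite divr_ge0 //= -exprM.
  (* Bernoulli's inequality gives [x^k >= 1 - 2k/D >= 1/2], since [k <= K = D/4]. *)
  have := exp_1B_ge (2 * k) dD; rewrite -/y.
  have : (2 * k)%:R * D%:R^-1 <= 2^-1 :> R.
    rewrite ler_pdivrMr // mulrC ler_pdivlMr // -natrM ler_nat /D; lia.
  lra.
have F_ge1 : 1 <= F by apply: le_trans F_ge; rewrite exprn_ege1 //; lra.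
have tail_le : psum (N + N) euler_fps x <= 2 * F.
  apply: le_trans (psum_tail_le _ _ euler_fps_ge0) _; first by rewrite y0.
  suff : y ^+ N * psum (N + N) euler_fps y <= 1 by rewrite -/x -/F; lra.
  have psum_le : psum (N + N) euler_fps y <= 512 ^+ D.
    have -> : (N + N = (N + N).-1.+1)%N by rewrite prednK // /N; nia.
    exact: psum_euler_le.
  (* The [9] in [N] is chosen for this: [y^D <= 1/2], so [y^N <= 2^(-9D)]. *)
  have yN_le : y ^+ N <= 512 ^- D.
    have yD : y ^+ D <= 2^-1.
      by apply: le_trans (exp_1B_le D dD) _; rewrite mulfV ?gt_eqF.
    have -> : 512 = 2 ^+ 9 :> R by ring.
    rewrite /N exprM [(9 * D)%N]mulnC exprM -!exprVn.
    by rewrite !lerXn2r ?nnegrE ?exprn_ge0 ?invr_ge0.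
  rewrite -(@mulVf _ (512 ^+ D)) ?expf_neq0 ?pnatr_eq0 //.
  apply: ler_pM => //; first by rewrite exprn_ge0.
  by rewrite psum_ge0 //; apply: euler_fps_ge0.
have F_sqr_le : F * F <= D%:R ^+ r * (2 * F).
  apply: le_trans (psum_mul_ge _ x0 euler_fps_ge0 euler_fps_ge0) _.
  have -> : fps_mul euler_fps euler_fps = b_coef.
    by rewrite /b_coef /fps_exp /= [fps_mul _ fps_one]fps_mulC fps_mul1.
  apply: (@le_trans _ _ (psum (N + N) (a_tilde r) x)).
    apply: ler_sum => i _; rewrite ler_wpM2r ?exprn_ge0 // ler_int b_le_a //.
    by rewrite defN.
  have inv_ge0 i : 0 <= fps_inv (fps_exp (one_sub_t int 1) r) i.
    exact: fps_inv_exp_one_sub_t_ge0.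
  apply: le_trans (psum_mul_le _ x0 inv_ge0 euler_fps_ge0) _.
  apply: ler_pM tail_le; rewrite ?psum_ge0 //; first exact: euler_fps_ge0.
  apply: le_trans (psum_exp_inv_one_sub_t_le _ _ _) _; first by rewrite x0.
  rewrite -exprVn lerXn2r ?nnegrE ?invr_ge0 ?subr_ge0 ?(ltW x1) //.
  by rewrite -[leRHS]invrK lef_pV2 ?posrE ?invr_gt0 ?subr_gt0.
(* Cancelling one positive factor [F] in [F_sqr_le] leaves [F <= 2 D^r]. *)
apply: le_trans F_ge _; rewrite -(ler_pM2r (lt_le_trans ltr01 F_ge1)).
by rewrite -mulrA mulrCA.
Qed.

End PartialSums.

(** * Choice of [K] and conclusion *)

(** Since [(3/2)^2 > 2], the right side exceeds [2^(16 r l)], while the left side is at most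
    [2^(1 + r (2l + 8))]. *)
Lemma exp_lt_exp_trunc_log (R : realFieldType) r (l := trunc_log 2 r)
    (K := (32 * (r * l))%N) : (2 <= r)%N ->
  2 * (4 * K)%:R ^+ r < (3 / 2) ^+ K :> R.
Proof.
move=> r2.
have l0 : (0 < l)%N by rewrite trunc_log_gt0.
have rl0 : (0 < r * l)%N by rewrite muln_gt0 l0 andbT ltnW.
have r_lt : (r < 2 ^ l.+1)%N by rewrite trunc_log_ltn.
(* [4K = 128 r l], with [r < 2 * 2^l] and [l < 2^l]. *)
have K_le : (4 * K <= 2 ^ (2 * l + 8))%N.
  have : (l < 2 ^ l)%N by rewrite ltn_expl.
  move: r_lt; rewrite expnD mul2n -addnn expnD expnS /K; move: (2 ^ l)%N => e.
  rewrite -[(2 ^ 8)%N]/256%N; nia.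
have -> : (3 / 2) ^+ K = (9 / 4) ^+ (16 * (r * l)) :> R.
  by rewrite /K -[32%N]/(2 * 16)%N -mulnA exprM; congr (_ ^+ _); field.
apply: (@le_lt_trans _ _ (2 ^+ (16 * (r * l)))); last first.
  rewrite ltr_pXn2r ?nnegrE //; [lra | by rewrite muln_gt0 | lra].
apply: (@le_trans _ _ (2 * (2 ^+ (2 * l + 8)) ^+ r)).
  by rewrite ler_wpM2l // lerXn2r ?nnegrE ?exprn_ge0 // -natrX ler_nat.
rewrite -exprM -exprS ler_weXn2l ?ler1n //; nia.
Qed.

Theorem theoremA7 (R : realType) :
  exists C4 : R, 0 < C4 /\
    forall r' : nat, (2 <= r')%N ->
      exists m : nat,
        m%:R <= C4 * r'%:R ^+ 2 * ln (r'%:R : R) ^+ 2 /\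
        a_tilde r' m < b_coef m.
Proof.
have ln2 : 0 < ln 2 :> R by rewrite ln_gt0 // ltr1n.
(* This constant comes from [m < 288 K^2] with [K = 32 r l] and [l <= ln r / ln 2]. *)
exists (288 * 32 ^+ 2 / ln 2 ^+ 2); split.
  by rewrite divr_gt0 ?mulr_gt0 ?exprn_gt0.
move=> r r2; set l := trunc_log 2 r; set K := (32 * (r * l))%N.
have l0 : (0 < l)%N by rewrite trunc_log_gt0.
have K0 : (0 < K)%N by rewrite !muln_gt0 l0 andbT; lia.
have [l_le r_lt] := andP (trunc_log_bounds (isT : 1 < 2)%N (ltnW r2)).
have : exists2 m, (m < 288 * K ^ 2)%N & a_tilde r m < b_coef m.
  apply: boolp.contrapT => no_m.
  have := exp_lt_exp_trunc_log R r2; rewrite ltNge => /negP; apply.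
  apply: exp_le_of_b_le_a K0 _ => m m_lt; rewrite leNgt; apply/negP => ab.
  by apply: no_m; exists m.
move=> [m m_lt ab]; exists m; split=> //.
have l_ln : l%:R * ln 2 <= ln (r%:R : R).
  rewrite mulr_natl -lnXn // ler_ln ?posrE ?exprn_gt0 ?ltr0n ?(ltnW r2) //.
  by rewrite -natrX ler_nat.
apply: (@le_trans _ _ (288 * 32 ^+ 2 * (r%:R ^+ 2 * l%:R ^+ 2))).
  rewrite -!natrX -!natrM ler_nat; apply: leq_trans (ltnW m_lt) _.
  by rewrite /K -mulnA leq_mul2l /= !expnMn.
have -> : 288 * 32 ^+ 2 / ln 2 ^+ 2 * r%:R ^+ 2 * ln r%:R ^+ 2 =
    288 * 32 ^+ 2 * (r%:R ^+ 2 * (ln r%:R ^+ 2 / ln 2 ^+ 2)) :> R by ring.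
rewrite ler_wpM2l ?mulr_ge0 ?exprn_ge0 // ler_wpM2l ?exprn_ge0 //.
rewrite ler_pdivlMr ?exprn_gt0 // -exprMn lerXn2r ?nnegrE //.
  by rewrite mulr_ge0 // ltW.
by rewrite ln_ge0 // ler1n ltnW.
Qed.
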